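(* Let $r\ge1$ and $n\geq 4r^2$ be integers. Then $\mathcal{G}(\mathrm{S}_{n,r})\leq \frac{2n}{r}+1$.
   Context: $\mathrm{S}_{n,r}$ denotes $\mathrm{S}_n$ acting naturally on the set of $r$-subsets of $[n]=\{1,\dots,n\}$. For a finite permutation group $G$ on $\Omega$, the greedy algorithm builds $\beta_1,\beta_2,\dots$ where each $\beta_i$ lies in a largest orbit of the pointwise stabiliser of $\{\beta_1,\dots,\beta_{i-1}\}$, stopping when this stabiliser is trivial; $\mathcal{G}(G)$ is the maximum number of points chosen, over all possible choices. *)

(* Defs.v *)
From mathcomp Require Import all_boot all_order all_algebra all_fingroup.
Set Implicit Arguments. Unset Strict Implicit. Unset Printing Implicit Defensive.
Local Open Scope group_scope.

(* S_{n,r}: Sym('I_n) = [set: {perm 'I_n}] acting naturally ('P^* = setact of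
   the natural permutation action) on Omega = the r-subsets of 'I_n. *)
Definition rsubsets (n r : nat) : {set {set 'I_n}} :=
  [set A : {set 'I_n} | #|A| == r].

(* pointwise stabiliser in S_n of the points listed in s *)
Definition ptstab (n : nat) (s : seq {set 'I_n}) : {set {perm 'I_n}} :=
  ('C([set:: s] | 'P^*))%g.

(* B lies in a largest orbit (on Omega) of the group H *)
Definition in_largest_orbit (n r : nat) (H : {set {perm 'I_n}}) (B : {set 'I_n}) :=
  B \in rsubsets n r /\
  forall C, C \in rsubsets n r ->
    #|orbit ('P^*)%act H C| <= #|orbit ('P^*)%act H B|.

(* s = [:: beta_1; ...; beta_k] is a complete run of the greedy algorithm for
   S_{n,r}: each beta_i is chosen (while the stabiliser of the previous points
   is nontrivial) in a largest orbit of that stabiliser, and the algorithm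
   stops when the stabiliser becomes trivial. *)
Definition greedy_run (n r : nat) (s : seq {set 'I_n}) : Prop :=
  (forall i, i < size s ->
     ptstab (take i s) != 1%g /\
     in_largest_orbit r (ptstab (take i s)) (nth set0 s i)) /\
  ptstab s = 1%g.
Arguments greedy_run : clear implicits.

(* Main.v *)
Require Import Defs.
From mathcomp Require Import all_boot all_order all_algebra all_fingroup.
From mathcomp Require Import zify.
Set Implicit Arguments. Unset Strict Implicit. Unset Printing Implicit Defensive.

(** The stabiliser of the chosen sets is the Young subgroup of their atoms, and
    a largest orbit is one that cannot be enlarged by exchanging a point of one
    atom for a point of another, which for a set [B] and atoms [P], [Q] reads
    [|P :&: B| |Q :\: B| <= (|P :\: B| + 1) (|Q :&: B| + 1)].
    Let [L] be the number of points not yet in any chosen set.  While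
    [L >= r^2 + r], the exchange inequality forces the whole next set into these
    [L] points; when this stops there are at least [3r] atoms of size [r].  From
    then on each set takes at most one point from each of the other atoms, the
    largest ones first, so these atoms stay of nearly equal size [M] and [L]
    stays below [M^2 + M].  The potential "[2 L] plus the sum of [|P| - 1] over
    the other atoms" starts at [2n] and drops by at least [r] in every round but
    the last two; the first phase gains enough to pay for those two. *)

(* [L] is the number of points in no chosen set, [S] lists the sizes of the
   other atoms (empty atoms are allowed).  A round splits an atom into a part of
   size [p.1] inside the new set and a part of size [p.2] outside it. *)
Inductive size_run (r : nat) : seq nat -> nat -> nat -> Prop :=
| SizeRunStop S L : size_run r S L 0
| SizeRunStep (D : seq (nat * nat)) (d : nat * nat) k :
    \sum_(p <- d :: D) p.1 = r ->
    {in d :: D &, forall p q : nat * nat, p.1 * q.2 <= p.2.+1 * q.1.+1} ->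
    0 < \sum_(p <- d :: D) (p.1 + p.2).-1 ->
    size_run r (d.1 :: unzip1 D ++ unzip2 D) d.2 k ->
    size_run r [seq p.1 + p.2 | p <- D] (d.1 + d.2) k.+1.

(** * Sums and counts over sequences *)

Lemma count_sum (T : Type) (a : pred T) (s : seq T) :
  count a s = \sum_(x <- s) (a x : nat).
Proof. by elim: s => [|x s IH]; rewrite ?big_nil // big_cons /= IH. Qed.

Lemma leq_sum_in (T : eqType) (s : seq T) (f g : T -> nat) :
  {in s, forall x, f x <= g x} -> \sum_(x <- s) f x <= \sum_(x <- s) g x.
Proof.
by move=> h; rewrite big_seq [leqRHS]big_seq; apply: leq_sum => x; apply: h.
Qed.

Lemma leq_term_sum (T : eqType) (s : seq T) (f : T -> nat) (x : T) :
  x \in s -> f x <= \sum_(y <- s) f y.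
Proof. by move=> xs; rewrite (big_rem x) //= leq_addr. Qed.

Lemma leq_term2_sum (T : eqType) (s : seq T) (f : T -> nat) (x y : T) :
  x \in s -> y \in s -> x != y -> f x + f y <= \sum_(z <- s) f z.
Proof.
move=> xs ys xy; rewrite (big_rem x) //= leq_add2l; apply: leq_term_sum.
by move: ys; rewrite (perm_mem (perm_to_rem xs)) inE eq_sym (negPf xy).
Qed.

Lemma sum_gt0_ex (T : eqType) (s : seq T) (f : T -> nat) :
  0 < \sum_(x <- s) f x -> exists2 x, x \in s & 0 < f x.
Proof.
rewrite lt0n sum_nat_seq_neq0 => /hasP[x xs /= fx].
by exists x; rewrite ?lt0n.
Qed.

Lemma sum_unzip (D : seq (nat * nat)) (f : nat -> nat) :
  \sum_(x <- unzip1 D ++ unzip2 D) f x = \sum_(p <- D) (f p.1 + f p.2).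
Proof. by rewrite big_cat !big_map big_split. Qed.

(** * The last rounds of a run *)

Lemma size_run_nontrivial r (S : seq nat) L k :
  size_run r S L k.+1 -> 0 < L.-1 + \sum_(x <- S) x.-1.
Proof.
move En : k.+1 => n run; case: run En => // D d k' _ _ + _ _.
by rewrite big_cons big_map.
Qed.

(** Apart from at most one pair, all atoms are empty or singletons, and a second round needs that
    pair unsplit. If it lies outside the new set, it violates exchange with a chosen point; if
    inside, exchange puts at least half of all points into the set, so there are at most [2 * r] of
    them. *)
Lemma size_run_end r (S : seq nat) L k :
  size_run r S L k -> 0 < r -> 2 * r < L + \sum_(x <- S) x ->
  L.-1 + \sum_(x <- S) x.-1 <= 1 -> k <= 1.
Proof.
case=> {S L k} [//|D d k sumD exch _ run] r0; rewrite !big_map => big le1.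
have {}big : 2 * r < \sum_(p <- d :: D) (p.1 + p.2) by rewrite big_cons.
have {}le1 : \sum_(p <- d :: D) (p.1 + p.2).-1 <= 1 by rewrite big_cons.
case: k run => [//|k] /size_run_nontrivial.
rewrite big_cons sum_unzip addnA [_.-1 + _.-1]addnC.
rewrite -(big_cons 0 addn d D xpredT (fun p => p.1.-1 + p.2.-1)).
case/sum_gt0_ex=> -[b c] pX /= touched.
have plt : (b + c).-1 <= 1.
  exact: leq_trans (leq_term_sum (fun p : nat * nat => (p.1 + p.2).-1) pX) le1.
have [b0|b0] := posnP b.
  have /sum_gt0_ex[[b' c'] qX /= b'0] : 0 < \sum_(q <- d :: D) q.1.
    by rewrite sumD.
  have neq : (b, c) != (b', c') by apply/eqP => -[e _]; move: b'0; lia.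
  have := leq_term2_sum (fun p : nat * nat => (p.1 + p.2).-1) pX qX neq.
  have c2 : c = 2 by lia.
  by have := exch _ _ qX pX; rewrite /= b0 c2; lia.
have : \sum_(q <- d :: D) (q.1 + q.2) <= \sum_(q <- d :: D) 2 * q.1.
  have [b2 c0] : b = 2 /\ c = 0 by lia.
  apply: leq_sum_in => -[b' c'] qX; have := exch _ _ pX qX.
  by rewrite b2 c0 /=; lia.
by rewrite -big_distrr sumD /=; lia.
Qed.

(* [M] bounds the sizes of the chosen atoms.  Each level [M] lasts for at least
   three rounds, and each round shrinks [L - M] by a factor [M / (M + 1)]; the
   three bounds on [L] record how far this has progressed. *)
Definition balanced (r M : nat) (S : seq nat) (L : nat) : Prop :=
  [/\ {in S, forall x, x <= M}, 3 * r <= count (fun x => M.-1 <= x) S,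
      0 < count_mem M S &
      [/\ L <= M ^ 2 + M,
          count_mem M S <= 2 * r -> L <= M ^ 2 &
          count_mem M S <= r -> L + M <= (M ^ 2).+1]].

(** The potential drop: a point taken from the unchosen ones goes from weight two to at most one,
    and one taken from an atom that keeps other points lowers the term of that atom by one. *)
Lemma sum_preds_next (D : seq (nat * nat)) (d : nat * nat) :
  {in D, forall p : nat * nat, p.1 = 0 \/ p.1 = 1 /\ 0 < p.2} ->
  2 * d.2 + \sum_(x <- d.1 :: unzip1 D ++ unzip2 D) x.-1 +
    \sum_(p <- d :: D) p.1 <=
  2 * (d.1 + d.2) + \sum_(p <- D) (p.1 + p.2).-1.
Proof.
move=> one; rewrite !big_cons sum_unzip.
have: \sum_(p <- D) (p.1.-1 + p.2.-1 + p.1) <= \sum_(p <- D) (p.1 + p.2).-1.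
  by apply: leq_sum_in => p /one; lia.
by rewrite big_split /=; lia.
Qed.

(** * One round from a balanced position *)

Section Step.

Variables (r M : nat) (D : seq (nat * nat)) (d : nat * nat).
Hypotheses (r_gt0 : 0 < r) (M_gt1 : 1 < M).
Hypothesis sumD : \sum_(p <- d :: D) p.1 = r.
Hypothesis exch :
  {in d :: D &, forall p q : nat * nat, p.1 * q.2 <= p.2.+1 * q.1.+1}.
Hypothesis bal : balanced r M [seq p.1 + p.2 | p <- D] (d.1 + d.2).

Let exchD (p q : nat * nat) :
  p \in D -> q \in D -> p.1 * q.2 <= p.2.+1 * q.1.+1.
Proof. by move=> pD qD; apply: exch; rewrite inE ?pD ?qD orbT. Qed.

Let exchl (p : nat * nat) : p \in D -> d.1 * p.2 <= d.2.+1 * p.1.+1.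
Proof. by move=> pD; apply: exch; rewrite inE ?pD ?orbT ?eqxx. Qed.

Let exchr (p : nat * nat) : p \in D -> p.1 * d.2 <= p.2.+1 * d.1.+1.
Proof. by move=> pD; apply: exch; rewrite inE ?pD ?orbT ?eqxx. Qed.

Let sumD' : d.1 + \sum_(p <- D) p.1 = r.
Proof. by rewrite -sumD big_cons. Qed.

Let leM (p : nat * nat) : p \in D -> p.1 + p.2 <= M.
Proof.
by case: bal => h _ _ _ pD; apply: h; apply/mapP; exists p.
Qed.

(** Exchange with an untouched atom of size [M] allows only single points from atoms of size exactly
    [M]. *)
Lemma balanced_same_level :
  has (fun p : nat * nat => (p.1 == 0) && (p.2 == M)) D ->
  {in D, forall p : nat * nat, p.1 = 0 \/ p.1 = 1 /\ 0 < p.2} /\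
  balanced r M (d.1 :: unzip1 D ++ unzip2 D) d.2.
Proof.
case/hasP=> u uD /andP[/eqP u1 /eqP u2].
have shape (p : nat * nat) : p \in D -> p.1 = 0 \/ p.1 = 1 /\ p.2.+1 = M.
  move=> pD; have := exchD pD uD; have := leM pD; rewrite u1 u2; nia.
split; first by move=> p /shape; lia.
case: bal; rewrite !count_map => _ many some [L0 L1 L2].
have dM : d.1 <= M by have := exchl uD; rewrite u1 u2; nia.
have eM : count_mem M [seq p.1 + p.2 | p <- D]
          <= count_mem M (unzip2 D) + \sum_(p <- D) p.1.
  rewrite !count_map !count_sum -big_split; apply: leq_sum_in => p /shape /=.
  lia.
have e' : count_mem M (unzip2 D) <= count_mem M (d.1 :: unzip1 D ++ unzip2 D).
  by rewrite /= count_cat; lia.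
have shrink : d.1 < r -> d.2 <= M * d.1.+1.
  move=> dr; have /sum_gt0_ex[p pD p1] : 0 < \sum_(p <- D) p.1 by lia.
  by have := exchr pD; case: (shape _ pD) => [|[-> ->]]; lia.
rewrite count_map in eM.
split.
- move=> x; rewrite inE mem_cat => /or3P[/eqP-> //| |] /mapP[p pD ->].
    by have := leM pD; lia.
  by have := leM pD; lia.
- apply: leq_trans many _; rewrite /= !count_cat !count_map !count_sum.
  rewrite addnA; apply: leq_trans (leq_addl _ _).
  by apply: leq_sum_in => p /shape /=; lia.
- apply: leq_trans e'; rewrite -has_count; apply/hasP; exists M => //=.
  by apply/mapP; exists u.
(* If [d.1 = r], no atom of size [M] is lost. Otherwise at most [r] are lost, so each conditional
   bound on [d.2] follows from [sh] and the next weaker bound on [d.1 + d.2]. *)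
case: (ltnP d.1 r) => [/shrink sh|dr]; split; try lia.
- by move=> _; nia.
- by move=> h; have: d.1 + d.2 <= M ^ 2; [apply: L1; lia | nia].
Qed.

Hypothesis all_touched :
  ~~ has (fun p : nat * nat => (p.1 == 0) && (p.2 == M)) D.

Let touched (p : nat * nat) : p \in D -> p.1 + p.2 = M -> 0 < p.1.
Proof.
move=> pD pM; rewrite lt0n; apply/eqP => p1; case/negP: all_touched.
by apply/hasP; exists p => //; apply/andP; split; apply/eqP; lia.
Qed.

(** At least [3 * r] atoms have size [M - 1] or [M], and the new set has only [r] points. *)
Let untouched : exists2 c, (0, c) \in D & c.+1 = M.
Proof.
case: bal; rewrite count_map count_sum => _ many _ _.
suff: has (fun p : nat * nat => (p.1 == 0) && (M.-1 <= p.2)) D.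
  case/hasP=> -[b c] pD /= /andP[/eqP b0 cM]; rewrite b0 in pD; exists c => //.
  by have := touched pD; have := leM pD; rewrite /=; lia.
rewrite has_count count_sum.
have: \sum_(p <- D) (preim (fun p => p.1 + p.2) (leq M.-1) p : nat) <=
      \sum_(p <- D) (((p.1 == 0) && (M.-1 <= p.2) : nat) + p.1).
  by apply: leq_sum_in => -[b c] _ /=; case: b => [|b]; lia.
by move: many; rewrite big_split /=; lia.
Qed.

Let shape (p : nat * nat) :
  p \in D -> p.1 = 0 /\ p.2 < M \/ p.1 = 1 /\ M <= p.2.+2 <= M.+1.
Proof.
case: untouched => c uD cM pD; have := exchD pD uD; have := leM pD.
by have := touched pD; rewrite /=; nia.
Qed.

(** Each atom of size [M] loses a point, so there are at most [r] of them and the strongest bound in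
    [balanced] applies. *)
Let rest_bounds : [/\ d.1 + d.2 + M <= (M ^ 2).+1, d.2 + M <= M ^ 2 &
  d.1 * M.-1 <= d.2.+1].
Proof.
case: bal; rewrite !count_map => _ _ some [_ _ L2].
have dL : d.1 + d.2 + M <= (M ^ 2).+1.
  apply: L2; apply: (@leq_trans (\sum_(p <- D) p.1)); last by lia.
  by rewrite count_sum; apply: leq_sum_in => p pD /=; have := touched pD; lia.
move: some; rewrite -has_count => /hasP[p pD /eqP pM].
have := exchr pD; have := touched pD pM; have := shape pD.
case: untouched => c uD cM; have := exchl uD; rewrite /= -cM /= => h1 h2 h3 h4.
have {}h4 : d.2 <= M * d.1.+1 by case: h2 h4 => [|[p1 h]]; nia.
by split; nia.
Qed.

Lemma balanced_next_level : 2 < M ->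
  {in D, forall p : nat * nat, p.1 = 0 \/ p.1 = 1 /\ 0 < p.2} /\
  balanced r M.-1 (d.1 :: unzip1 D ++ unzip2 D) d.2.
Proof.
move=> M2; split; first by move=> p /shape; lia.
case: rest_bounds => dL d2M d1M.
have dM : d.1 < M by nia.
case: bal => _ many some _.
have e' : 2 * r < count_mem M.-1 (unzip2 D).
  (* An atom of size [M] counts twice on both sides: it loses one point and keeps [M - 1]. As such
     an atom exists, the final inequality is strict. *)
  have: count (fun x => M.-1 <= x) [seq p.1 + p.2 | p <- D] +
        count_mem M [seq p.1 + p.2 | p <- D] <=
        count_mem M.-1 (unzip2 D) + \sum_(p <- D) p.1.
    rewrite !count_map !count_sum -!big_split; apply: leq_sum_in => p pD /=.
    by have := shape pD; have := leM pD; lia.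
  by lia.
have e'' : 2 * r < count_mem M.-1 (d.1 :: unzip1 D ++ unzip2 D).
  by apply: leq_trans e' _; rewrite /= count_cat addnA leq_addl.
split; [| | by lia |].
- move=> x; rewrite inE mem_cat => /or3P[/eqP-> | |]; first by lia.
    by case/mapP=> p pD ->; have := shape pD; lia.
  by case/mapP=> p pD ->; have := shape pD; have := leM pD; lia.
- apply: leq_trans many _; rewrite /= !count_cat !count_map !count_sum.
  rewrite addnA; apply: leq_trans (leq_addl _ _).
  by apply: leq_sum_in => p /shape /=; lia.
(* More than [2 * r] atoms have the new top size, so only the unconditional bound has content, and
   it is [d2M]. *)
by split; [nia | lia | lia].
Qed.

Lemma preds_sum_last_level : M = 2 ->
  d.2.-1 + \sum_(x <- d.1 :: unzip1 D ++ unzip2 D) x.-1 <= 1.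
Proof.
move=> M2; case: rest_bounds; rewrite M2 /= => dL d2M d1M.
rewrite big_cons sum_unzip.
have -> : \sum_(p <- D) (p.1.-1 + p.2.-1) = 0.
  by rewrite big_seq big1 // => p /shape; lia.
by lia.
Qed.

End Step.

(** * Length of a run of sizes *)

(** The summand [2 * r] pays for the last two rounds, in which the potential may drop by less than
    [r]. *)
Lemma size_run_balanced r M (S : seq nat) L k :
  0 < r -> 0 < M -> 2 * r < L + \sum_(x <- S) x -> balanced r M S L ->
  size_run r S L k -> r * k <= 2 * L + \sum_(x <- S) x.-1 + 2 * r.
Proof.
move=> r0; elim: k M S L => [|k IH] M S L M0 total bal run; first by lia.
have [M1|M1] := leqP M 1.
  have M1' : M = 1 by lia.
  suff: k.+1 <= 1 by nia.
  apply: size_run_end run r0 total _; case: bal => le1 _ _ [L1 _ _].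
  rewrite big_seq big1; last by move=> x /le1; lia.
  by move: L1; rewrite M1' /=; lia.
move Ek : k.+1 run => k' run; case: run Ek total bal => // {S L k'}.
move=> D d k' sumD exch _ run [kE] total bal; rewrite -{k'}kE in run *.
have total' : 2 * r < d.2 + \sum_(x <- d.1 :: unzip1 D ++ unzip2 D) x.
  by move: total; rewrite big_cons sum_unzip big_map; lia.
rewrite big_map.
have [same|] := boolP (has (fun p : nat * nat => (p.1 == 0) && (p.2 == M)) D).
  have [one bal'] := balanced_same_level r0 M1 sumD exch bal same.
  have := IH _ _ _ M0 total' bal' run; have := sum_preds_next d one.
  by rewrite sumD; lia.
move=> all_touched; have [M2|M2] := ltnP 2 M.
  have [one bal'] := balanced_next_level r0 M1 sumD exch bal all_touched M2.
  have := IH _ _ _ _ total' bal' run; have := sum_preds_next d one.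
  by rewrite sumD; lia.
have M2' : M = 2 by lia.
have := size_run_end run r0 total'
  (preds_sum_last_level r0 M1 sumD exch bal all_touched M2').
by nia.
Qed.

(** The run is balanced at level [r], and the at least [3 * r] atoms of size [r] cover both the
    [2 * r] of [size_run_balanced] and the [r] on the left. *)
Lemma size_run_late n r (S : seq nat) L k :
  0 < r -> 4 * r ^ 2 <= n -> L < r ^ 2 + r -> {in S, forall x, x <= r} ->
  L + \sum_(x <- S) x = n -> L + r * count_mem r S = n ->
  size_run r S L k ->
  r * k + r <= 2 * L + \sum_(x <- S) x.-1 + count_mem r S.
Proof.
move=> r0 nr small ler total Ln run.
have many : 3 * r <= count_mem r S by nia.
have large : 2 * r < L + \sum_(x <- S) x by rewrite total; nia.
suff bal : balanced r r S L.
  by have := size_run_balanced r0 r0 large bal run; lia.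
split; [by [] | apply: leq_trans many (sub_count _ _) | lia | split; lia].
by move=> x /= /eqP->; apply: leq_pred.
Qed.

(** The two equations say that all nonempty atoms have size [r], as in the first phase. A round of
    that phase lowers [2 * L] by [2 * r], while its new atom adds [r - 1] to the sum and one to the
    count. *)
Lemma size_run_bound n r (S : seq nat) L k :
  0 < r -> 4 * r ^ 2 <= n -> {in S, forall x, x <= r} ->
  L + \sum_(x <- S) x = n -> L + r * count_mem r S = n ->
  size_run r S L k ->
  r * k + r <= 2 * L + \sum_(x <- S) x.-1 + count_mem r S.
Proof.
move=> r0 nr; elim: k S L => [|k IH] S L ler total Ln run;
  (have [small|big] := ltnP L (r ^ 2 + r);
    first exact: size_run_late small ler total Ln run).
- by nia.
move Ek : k.+1 run => k' run; case: run Ek ler total Ln big => // {S L k'}.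
move=> D d k' sumD exch _ run [kE] ler total Ln big; rewrite -{k'}kE in run *.
have sumD' : d.1 + \sum_(p <- D) p.1 = r by rewrite -sumD big_cons.
have ler' (p : nat * nat) : p \in D -> p.1 + p.2 <= r.
  by move=> pD; apply: ler; apply/mapP; exists p.
(* If [p.1 > 0], then [p.2.+1] and [d.1.+1] are at most [r], whereas [d.2 > r ^ 2], against
   exchange. *)
have untouched (p : nat * nat) : p \in D -> p.1 = 0.
  move=> pD; have := exch p d; rewrite !inE pD eqxx orbT => /(_ isT isT).
  have := leq_term_sum (fun p : nat * nat => p.1) pD; have := ler' _ pD.
  by rewrite /=; nia.
have sum0 : \sum_(p <- D) p.1 = 0.
  by rewrite big_seq big1 // => p /untouched.
have d1 : d.1 = r by lia.
have cnt : count_mem r (d.1 :: unzip1 D ++ unzip2 D) =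
           (count_mem r [seq p.1 + p.2 | p <- D]).+1.
  rewrite /= count_cat d1 eqxx !count_map add1n; congr _.+1.
  rewrite !count_sum -big_split; apply: eq_big_seq => p /untouched /= ->.
  by rewrite add0n; lia.
have := IH (d.1 :: unzip1 D ++ unzip2 D) d.2.
rewrite cnt !big_cons !sum_unzip.
have le : \sum_(p <- D) (p.1.-1 + p.2.-1) <= \sum_(p <- D) (p.1 + p.2).-1.
  by apply: leq_sum_in => p /untouched; lia.
move: total Ln; rewrite !big_map => total Ln IH'.
suff: r * k + r <= 2 * d.2 + (d.1.-1 + \sum_(p <- D) (p.1.-1 + p.2.-1)) +
   (count_mem r [seq p.1 + p.2 | p <- D]).+1 by lia.
apply: IH' run; [| by lia | by lia].
move=> x; rewrite inE mem_cat => /or3P[/eqP-> | |]; first by lia.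
  by case/mapP=> p pD ->; have := ler' _ pD; lia.
by case/mapP=> p pD ->; have := ler' _ pD; lia.
Qed.

Lemma size_run_le n r k :
  0 < r -> 4 * r ^ 2 <= n -> size_run r [::] n k -> r * k <= 2 * n.
Proof.
move=> r0 nr /(size_run_bound r0 nr).
rewrite !big_nil muln0 !addn0 => h; apply: leq_trans (h _ erefl erefl) => //.
by rewrite leq_addr.
Qed.

(** * Stabilisers and exchange of points *)

Section Stabilisers.

Variable n : nat.
Implicit Types (s : seq {set 'I_n}) (A B P Q : {set 'I_n}) (x y : 'I_n).
Implicit Types h : {perm 'I_n}.

Lemma ptstabP s h : reflect (forall B, B \in s -> h @: B = B) (h \in ptstab s).
Proof.
apply: (iffP astabP) => hs B.
  by move=> Bs; have := hs B; rewrite inE => /(_ Bs).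
by rewrite inE => /hs.
Qed.

Canonical ptstab_group s := [group of ptstab s].

Lemma mem_ptstab_set h B x : h @: B = B -> (h x \in B) = (x \in B).
Proof. by move=> hB; rewrite -{1}hB mem_imset //; apply: perm_inj. Qed.

Definition cell s x := [set y | all (fun B => (y \in B) == (x \in B)) s].

Lemma cellP s x y :
  reflect (forall B, B \in s -> (y \in B) = (x \in B)) (y \in cell s x).
Proof.
rewrite inE; apply: (iffP allP) => h B /h; first by move/eqP.
by move->.
Qed.

Lemma cell_cons B s x :
  cell (B :: s) x = cell s x :&: [set y | (y \in B) == (x \in B)].
Proof. by apply/setP => y; rewrite !inE andbC. Qed.

Lemma cell_refl s x : x \in cell s x.
Proof. by apply/cellP. Qed.

Lemma cell_eq s x y : y \in cell s x -> cell s y = cell s x.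
Proof.
move=> /cellP xy; apply/setP => z; apply/cellP/cellP => h B Bs.
  by rewrite h // xy.
by rewrite h // xy.
Qed.

Lemma tperm_ptstab s x y : y \in cell s x -> tperm x y \in ptstab s.
Proof.
move=> /cellP xy; apply/ptstabP => B Bs; apply/eqP.
rewrite eqEcard card_imset ?leqnn ?andbT; last exact: perm_inj.
apply/subsetP => _ /imsetP[z zB ->]; case: tpermP => // zE.
  by rewrite xy // -zE.
by rewrite -xy // -zE.
Qed.

Lemma orbit_ptstab s x : orbit 'P (ptstab s) x = cell s x.
Proof.
apply/setP => y; apply/orbitP/idP => [[h /ptstabP hs <-]|xy].
  by apply/cellP => B Bs; rewrite /= apermE mem_ptstab_set // hs.
by exists (tperm x y); rewrite ?tperm_ptstab //= apermE tpermL.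
Qed.

(** Fixing [x] means stabilising [[set x]], so point stabilisers are again of the form [ptstab]. *)
Lemma card_ptstab_set1 s x :
  #|ptstab s| = #|cell s x| * #|ptstab ([set x] :: s)|.
Proof.
rewrite -orbit_ptstab -(card_orbit_stab 'P [group of ptstab s] x) /=.
congr (_ * _); apply: eq_card => h; rewrite in_setI.
apply/andP/ptstabP => [[/ptstabP hs /astab1P /= hx] B|hs].
  by rewrite inE => /predU1P[->|/hs //]; rewrite imset_set1 -apermE hx.
split; first by apply/ptstabP => B Bs; apply: hs; rewrite inE Bs orbT.
apply/astab1P; apply/set1P; rewrite /= apermE -(hs [set x]) ?mem_head //.
by rewrite imset_f ?set11.
Qed.

Lemma card_orbit_ptstab s B :
  #|orbit 'P^* (ptstab s) B| * #|ptstab (B :: s)| = #|ptstab s|.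
Proof.
rewrite -(card_orbit_stab ('P^*) [group of ptstab s] B) /=.
congr (_ * _); apply: eq_card => h; rewrite [in RHS]in_setI.
apply/ptstabP/andP => [hs|[/ptstabP hs /astab1P hB] C].
  split; first by apply/ptstabP => C Cs; apply: hs; rewrite inE Cs orbT.
  by apply/astab1P; apply: hs; rewrite mem_head.
by rewrite inE => /predU1P[->|/hs].
Qed.

Lemma perm_stab_swap h B x y :
  h x = x -> h y = y -> h @: B = B -> h @: (y |: B :\ x) = y |: B :\ x.
Proof.
move=> hx hy hB; rewrite imsetU1 hy; congr (_ |: _); apply/setP => z.
rewrite -{2}hB -(permKV h z) !mem_imset ?in_setD1; try exact: perm_inj.
rewrite mem_imset; last exact: perm_inj.
by rewrite -{2}hx (inj_eq perm_inj).
Qed.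

Lemma ptstab_swap s B x y : x \in B -> y \notin B ->
  ptstab ([set y] :: [set x] :: y |: B :\ x :: s) =
  ptstab ([set y] :: [set x] :: B :: s).
Proof.
move=> xB yB; apply/setP => h.
have sub (C C' : {set 'I_n}) :
  (h x = x -> h y = y -> h @: C = C -> h @: C' = C') ->
  h \in ptstab ([set y] :: [set x] :: C :: s) ->
  h \in ptstab ([set y] :: [set x] :: C' :: s).
  move=> CC' /ptstabP hs.
  have fixp z : [set z] \in [:: [set y], [set x], C & s] -> h z = z.
    by move=> /hs hz; apply/set1P; rewrite -hz imset_f ?set11.
  apply/ptstabP => A; rewrite !inE => /or4P[/eqP->|/eqP->|/eqP->|As].
  - by apply: hs; rewrite !inE eqxx.
  - by apply: hs; rewrite !inE eqxx orbT.
  - by apply: CC'; [apply: fixp | apply: fixp | apply: hs];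
      rewrite !inE eqxx ?orbT.
  - by apply: hs; rewrite !inE As !orbT.
have Bswap : x |: (y |: B :\ x) :\ y = B.
  by rewrite setU1K ?setD1K // in_setD1 negb_and yB orbT.
apply/idP/idP; apply: sub => hx hy hB; last exact: perm_stab_swap.
by rewrite -Bswap perm_stab_swap.
Qed.

(* The pointwise stabilisers of [x] and [y] in the stabilisers of [B] and of
   [B - x + y] coincide, so the two orbit lengths are compared through the
   lengths of the orbits of [x] and [y]. *)
Lemma largest_orbit_exchange r s B x y :
  in_largest_orbit r (ptstab s) B -> x \in B -> y \notin B ->
  #|cell s x :&: B| * #|cell s y :\: B| <=
    #|cell s x :\: B|.+1 * #|cell s y :&: B|.+1.
Proof.
case=> Br largest xB yB.
have [/cell_eq-> | ncell] := boolP (y \in cell s x).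
  by rewrite mulnC leq_mul.
have ncell' : x \notin cell s y.
  by apply: contra ncell => /cell_eq ->; apply: cell_refl.
have xy : y != x by apply: contraNneq yB => ->.
pose B' := y |: B :\ x.
have le_orb : #|orbit 'P^* (ptstab s) B'| <= #|orbit 'P^* (ptstab s) B|.
  apply: largest; move: Br; rewrite !inE /B' cardsU1 (cardsD1 x B) xB.
  by rewrite in_setD1 (negPf yB) andbF.
(* By orbit-stabiliser, a larger orbit means a smaller stabiliser. *)
have le_stab : #|ptstab (B :: s)| <= #|ptstab (B' :: s)|.
  have orb0 : 0 < #|orbit 'P^* (ptstab s) B|.
    by apply/card_gt0P; exists B; apply: (orbit_refl _ [group of ptstab s]).
  rewrite -(leq_pmul2l orb0) card_orbit_ptstab -(card_orbit_ptstab s B').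
  by rewrite leq_pmul2r //; apply: (cardG_gt0 [group of ptstab (B' :: s)]).
have K0 : 0 < #|ptstab [:: [set y], [set x], B & s]|.
  exact: (cardG_gt0 [group of ptstab _]).
move: le_stab; rewrite (card_ptstab_set1 _ x) (card_ptstab_set1 _ y) mulnA.
rewrite (card_ptstab_set1 (B' :: s) x).
rewrite (card_ptstab_set1 ([set x] :: _) y) mulnA.
rewrite ptstab_swap // leq_pmul2r // => le.
(* [E1] and [E2] bound the left factors of [le] from below, [E3] and [E4] the right ones from above;
   [x] and [y] themselves give the successors. *)
have E1 : cell s x :&: B \subset cell (B :: s) x.
  by apply/subsetP => z; rewrite cell_cons !in_setI inE xB => /andP[-> ->].
have E2 : cell s y :\: B \subset cell [:: [set x], B & s] y.
  apply/subsetP => z; rewrite !cell_cons in_setD !in_setI !inE (negPf yB).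
  move=> /andP[zB ->]; rewrite (negPf zB) (negPf xy) /=.
  by rewrite eqbF_neg; apply: contraNneq zB => ->.
have E3 : cell (B' :: s) x \subset x |: cell s x :\: B.
  apply/subsetP => z; rewrite cell_cons in_setI in_set => /andP[].
  rewrite !inE => zx.
  rewrite eqxx [x == y]eq_sym (negPf xy) /= eqbF_neg negb_or.
  by rewrite negb_and negbK => /andP[_ /orP[->|->]] //; rewrite zx orbT.
have E4 : cell [:: [set x], B' & s] y \subset y |: cell s y :&: B.
  apply/subsetP => z; rewrite !cell_cons !inE => /andP[/andP[zy]].
  rewrite eqxx (negPf xy) /= eqb_id eqbF_neg => h zx.
  by move: h; rewrite (negPf zx) /=; case: eqP => //= _ ->; rewrite zy.
apply: leq_trans (leq_mul (subset_leq_card E1) (subset_leq_card E2)) _.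
apply: leq_trans le _; apply: leq_mul.
  by apply: leq_trans (subset_leq_card E3) _;
    rewrite cardsU1; case: (_ \notin _).
by apply: leq_trans (subset_leq_card E4) _;
  rewrite cardsU1; case: (_ \notin _).
Qed.

(** * Atoms of the chosen sets *)

Fixpoint unchosen s := if s is B :: s' then unchosen s' :\: B else setT.

(** Empty atoms are kept, and the order is that of the list in [SizeRunStep]. *)
Fixpoint chosen_atoms s :=
  if s is B :: s' then
    (unchosen s' :&: B) ::
    [seq P :&: B | P <- chosen_atoms s'] ++ [seq P :\: B | P <- chosen_atoms s']
  else [::].

Definition atoms s := unchosen s :: chosen_atoms s.

Lemma mem_atoms_cons B s P : P \in atoms (B :: s) ->
  exists2 Q, Q \in atoms s & P = Q :&: B \/ P = Q :\: B.
Proof.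
rewrite !inE mem_cat => /or4P[/eqP->|/eqP->|/mapP[Q Qs ->]|/mapP[Q Qs ->]].
- by exists (unchosen s); [rewrite mem_head | right].
- by exists (unchosen s); [rewrite mem_head | left].
- by exists Q; [rewrite inE Qs orbT | left].
- by exists Q; [rewrite inE Qs orbT | right].
Qed.

Lemma atom_cell s P x : P \in atoms s -> x \in P -> P = cell s x.
Proof.
elim: s P => [|B s IH] P.
  by rewrite inE => /eqP-> _; apply/setP => z; rewrite !inE.
case/mem_atoms_cons=> Q Qs [->|->] => [/setIP[xQ xB]|/setDP[xQ xB]].
  rewrite cell_cons -(IH _ Qs xQ); apply/setP => z.
  by rewrite !in_setI in_set xB eqb_id.
rewrite cell_cons -(IH _ Qs xQ); apply/setP => z.
by rewrite in_setD in_setI in_set (negPf xB) eqbF_neg andbC.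
Qed.

(** This expresses that the atoms partition the points; splitting every atom by [B] amounts to
    splitting [A] by [B]. *)
Lemma sum_card_atoms s A : \sum_(P <- atoms s) #|P :&: A| = #|A|.
Proof.
elim: s => [|B s IH] in A *; first by rewrite big_seq1 setTI.
have split P : #|P :&: (A :&: B)| + #|P :&: (A :\: B)| =
               #|P :&: B :&: A| + #|(P :\: B) :&: A|.
  by rewrite [A :&: B]setIC setIA [(P :\: B) :&: A]setIDAC setIDA.
rewrite -(cardsID B A) -(IH (A :&: B)) -(IH (A :\: B)) -big_split /=.
under [RHS]eq_bigr do rewrite split.
by rewrite !big_cons big_cat !big_map big_split /= addnCA addnA.
Qed.

Lemma mem_some_atom s x : exists2 P, P \in atoms s & x \in P.
Proof.
have := sum_card_atoms s [set x]; rewrite cards1 => sum1.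
have /sum_gt0_ex[P Ps] : 0 < \sum_(P <- atoms s) #|P :&: [set x]|.
  by rewrite sum1.
by case/card_gt0P=> y /setIP[yP /set1P<-]; exists P.
Qed.

Lemma largest_orbit_atoms r s B P Q :
  in_largest_orbit r (ptstab s) B -> P \in atoms s -> Q \in atoms s ->
  #|P :&: B| * #|Q :\: B| <= #|P :\: B|.+1 * #|Q :&: B|.+1.
Proof.
move=> largest Ps Qs.
have [->|[x /setIP[xP xB]]] := set_0Vmem (P :&: B); first by rewrite cards0.
have [->|[y /setDP[yQ yB]]] := set_0Vmem (Q :\: B).
  by rewrite cards0 muln0.
by rewrite (atom_cell Ps xP) (atom_cell Qs yQ); apply:
  (largest_orbit_exchange largest).
Qed.

Lemma ptstab_nontrivial s :
  ptstab s != 1%g -> 0 < \sum_(P <- atoms s) #|P|.-1.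
Proof.
apply: contraNltn; rewrite leqn0 => /eqP sum0.
apply/eqP/setP => h; apply/idP/set1P => [/ptstabP hs|->]; last exact: group1.
apply/permP => x; rewrite perm1.
have [P Ps xP] := mem_some_atom s x.
have hxP : h x \in P.
  by rewrite (atom_cell Ps xP); apply/cellP => B Bs; rewrite mem_ptstab_set ?hs.
have /card_le1_eqP : #|P| <= 1.
  by have := leq_term_sum (fun P => #|P|.-1) Ps; rewrite sum0; lia.
by move=> h1; apply: h1.
Qed.

(** Here [s] holds the sets already chosen, latest first, and [u] those still to come. *)
Lemma greedy_size_run r s u :
  (forall i, i < size u ->
     ptstab (rev (take i u) ++ s) != 1%g /\
     in_largest_orbit r (ptstab (rev (take i u) ++ s)) (nth set0 u i)) ->
  size_run r [seq #|P| | P <- chosen_atoms s] #|unchosen s| (size u).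
Proof.
elim: u s => [|B u IH] s run; first exact: SizeRunStop.
have [nontriv largest] := run 0 isT.
pose split P := (#|P :&: B|, #|P :\: B|).
have step := @SizeRunStep r (map split (chosen_atoms s)) (split (unchosen s)).
have sizes P : (split P).1 + (split P).2 = #|P| by apply: cardsID.
have -> : [seq #|P| | P <- chosen_atoms s] =
          [seq p.1 + p.2 | p <- map split (chosen_atoms s)].
  by rewrite -map_comp; apply: eq_map => P /=; rewrite -sizes.
rewrite -[X in size_run r _ X]sizes; apply: step.
- rewrite -map_cons big_map /= sum_card_atoms; apply/eqP.
  by case: largest; rewrite inE.
- move=> p q; rewrite -map_cons => /mapP[P Ps ->] /mapP[Q Qs ->].
  exact: largest_orbit_atoms largest Ps Qs.
- rewrite -map_cons big_map; under eq_bigr do rewrite sizes.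
  exact: ptstab_nontrivial.
have := IH (B :: s); rewrite /= map_cat /unzip1 /unzip2 -!map_comp; apply.
by move=> i iu; have := run i.+1 iu; rewrite /= rev_cons cat_rcons.
Qed.

End Stabilisers.

Lemma greedy_run_size_run n r (s : seq {set 'I_n}) :
  greedy_run n r s -> size_run r [::] n (size s).
Proof.
case=> run _; have := @greedy_size_run n r [::] s.
rewrite /= cardsT card_ord; apply=> i /run; rewrite cats0.
(* The stabiliser depends only on the set of entries, not on their order. *)
suff -> : ptstab (rev (take i s)) = ptstab (take i s) by [].
by rewrite /ptstab; congr (astab _ _); apply/setP => B; rewrite !inE mem_rev.
Qed.

Local Open Scope ring_scope.

(* G(S_{n,r}) <= 2n/r + 1, i.e. every greedy run has length <= 2n/r + 1 *)
Theorem theorem2p8 (n r : nat) :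
  (1 <= r)%N -> (4 * r ^ 2 <= n)%N ->
  forall s : seq {set 'I_n}, greedy_run n r s ->
    (size s)%:R <= 2 * n%:R / r%:R + 1 :> rat.
Proof.
move=> r0 nr s /greedy_run_size_run/(size_run_le r0 nr) le.
apply: (@Order.POrderTheory.le_trans _ _ (2 * n%:R / r%:R)); last first.
  by rewrite Num.Theory.lerDl.
rewrite Num.Theory.ler_pdivlMr ?Num.Theory.ltr0n //.
by rewrite -!GRing.natrM Num.Theory.ler_nat mulnC.
Qed.
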